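(* For every positive integer $k$, $$H_k(q;a,b,c,d)=\sum_{j=0}^{k+1}\frac{u_j(a,b,c,d)\,q^{\binom{k+1-j}{2}}}{(q;q)_{k+1-j}},$$ where for all $n\ge0$ $$u_{2n}(a,b,c,d)=(1-b)\sum_{\ell=0}^{n}\frac{(-aq^{2\ell+1};q^2)_{n-\ell}(-dq^{2\ell+1};q^2)_{n-\ell}}{(bq^{2\ell};q^2)_{n-\ell+1}(cq^{2\ell+1};q^2)_{n-\ell}}\frac{q^{2\ell}}{(q;q)_{2\ell}},$$ $$u_{2n+1}(a,b,c,d)=(b-1)\sum_{\ell=0}^{n}\frac{(-aq^{2\ell+2};q^2)_{n-\ell}(-dq^{2\ell+2};q^2)_{n-\ell}}{(bq^{2\ell+1};q^2)_{n-\ell+1}(cq^{2\ell+2};q^2)_{n-\ell}}\frac{q^{2\ell+1}}{(q;q)_{2\ell+1}}.$$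
   Context: $(x;q)_n=\prod_{i=0}^{n-1}(1-xq^i)$. The sequence $(H_k(q;a,b,c,d))_{k\ge-3}$ of rational functions is defined by $H_{-1}=1$, $H_{-2}=0$, $H_{-3}=\frac{(b-1)cq}{ad}$ and, for $k\ge0$, $$(1-cq^k)(1-bq^{k+1})H_k=(1-bcq^{2k})H_{k-1}+(aq^k+dq^k+adq^{2k})H_{k-2}+adq^{2k-1}H_{k-3}.$$ (In particular $H_0=\frac{1}{1-bq}$ and $H_1=\frac{1-bcq^2}{(1-cq)(1-bq)(1-bq^2)}+\frac{aq+dq+adq^2}{(1-cq)(1-bq^2)}$.) *)

(* Defs.v *)
From mathcomp Require Import all_boot all_order all_algebra.
From mathcomp Require Import mpoly.

Set Implicit Arguments.
Unset Strict Implicit.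
Unset Printing Implicit Defensive.

Import GRing.Theory.
Local Open Scope ring_scope.

Section Field.
Variable F : fieldType.
Implicit Types (x q a b c d : F) (H : int -> F).

Definition qpoch x q (n : nat) : F := \prod_(i < n) (1 - x * q ^+ i).

(* The values of H at indices below -3 are irrelevant and left unconstrained. *)
Definition is_Hseq q a b c d H : Prop :=
  [/\ H (-1) = 1,
      H (-2%:Z) = 0,
      H (-3%:Z) = ((b - 1) * c * q) / (a * d)
    & forall k : nat,
        (1 - c * q ^+ k) * (1 - b * q ^+ k.+1) * H k%:Z
        = (1 - b * c * q ^+ (2 * k)) * H (k%:Z - 1)
          + (a * q ^+ k + d * q ^+ k + a * d * q ^+ (2 * k)) * H (k%:Z - 2%:Z)
          + a * d * q ^ (2%:Z * k%:Z - 1) * H (k%:Z - 3%:Z)].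

Definition u_even q a b c d (n : nat) : F :=
  (1 - b) * \sum_(l < n.+1)
    (qpoch (- a * q ^+ (2 * l + 1)) (q ^+ 2) (n - l)
     * qpoch (- d * q ^+ (2 * l + 1)) (q ^+ 2) (n - l))
    / (qpoch (b * q ^+ (2 * l)) (q ^+ 2) (n - l + 1)
       * qpoch (c * q ^+ (2 * l + 1)) (q ^+ 2) (n - l))
    * (q ^+ (2 * l) / qpoch q q (2 * l)).

Definition u_odd q a b c d (n : nat) : F :=
  (b - 1) * \sum_(l < n.+1)
    (qpoch (- a * q ^+ (2 * l + 2)) (q ^+ 2) (n - l)
     * qpoch (- d * q ^+ (2 * l + 2)) (q ^+ 2) (n - l))
    / (qpoch (b * q ^+ (2 * l + 1)) (q ^+ 2) (n - l + 1)
       * qpoch (c * q ^+ (2 * l + 2)) (q ^+ 2) (n - l))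
    * (q ^+ (2 * l + 1) / qpoch q q (2 * l + 1)).

Definition u q a b c d (m : nat) : F :=
  if odd m then u_odd q a b c d m./2 else u_even q a b c d m./2.

Lemma u_double q a b c d n : u q a b c d (2 * n) = u_even q a b c d n.
Proof. by rewrite /u mul2n odd_double doubleK. Qed.

Lemma u_doubleS q a b c d n : u q a b c d (2 * n).+1 = u_odd q a b c d n.
Proof. by rewrite /u mul2n /= odd_double uphalf_double. Qed.

(* (H_(n-3), H_(n-2), H_(n-1)) *)
Fixpoint Htriple q a b c d (n : nat) : F * F * F :=
  if n is k.+1 then
    let: (h3, h2, h1) := Htriple q a b c d k in
    (h2, h1,
     ((1 - b * c * q ^+ (2 * k)) * h1
      + (a * q ^+ k + d * q ^+ k + a * d * q ^+ (2 * k)) * h2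
      + a * d * q ^ (2%:Z * k%:Z - 1) * h3)
     / ((1 - c * q ^+ k) * (1 - b * q ^+ k.+1)))
  else (((b - 1) * c * q) / (a * d), 0, 1).

Lemma is_Hseq_exists q a b c d :
    (forall k, 1 - c * q ^+ k != 0) -> (forall k, 1 - b * q ^+ k.+1 != 0) ->
  exists H, is_Hseq q a b c d H.
Proof.
move=> nzc nzb; pose h n := (Htriple q a b c d n).1.1.
have h1E n : (Htriple q a b c d n).1.2 = h n.+1.
  by rewrite /h /=; case: (Htriple _ _ _ _ _ n) => [[]].
have h2E n : (Htriple q a b c d n).2 = h n.+2.
  by rewrite -h1E /=; case: (Htriple _ _ _ _ _ n) => [[]].
exists (fun i => h `|(i + 3%:Z)%R|%N); split=> // k.
have -> : `|(k%:Z + 3%:Z)%R|%N = k.+3 by rewrite -PoszD addn3.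
have -> : `|(k%:Z - 1 + 3%:Z)%R|%N = k.+2.
  by rewrite -addrA -[-1 + 3%:Z]/(2%:Z) -PoszD addn2.
have -> : `|(k%:Z - 2%:Z + 3%:Z)%R|%N = k.+1.
  by rewrite -addrA -[- 2%:Z + 3%:Z]/(1%:Z) -PoszD addn1.
have -> : `|(k%:Z - 3%:Z + 3%:Z)%R|%N = k by rewrite subrK.
rewrite -(h2E k.+1) -(h2E k) -(h1E k) /h /=.
case: (Htriple _ _ _ _ _ k) => [[h3 h2] h1] /=.
by rewrite mulrC divfK // mulf_neq0.
Qed.

Lemma is_Hseq_unique q a b c d H H' :
    (forall k, 1 - c * q ^+ k != 0) -> (forall k, 1 - b * q ^+ k.+1 != 0) ->
    is_Hseq q a b c d H -> is_Hseq q a b c d H' ->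
  forall n : nat, H (n%:Z - 3%:Z) = H' (n%:Z - 3%:Z).
Proof.
move=> nzc nzb [H1 H2 H3 Hr] [H1' H2' H3' Hr'] n.
have : [/\ H (n%:Z - 3%:Z) = H' (n%:Z - 3%:Z),
           H (n%:Z - 2%:Z) = H' (n%:Z - 2%:Z)
         & H (n%:Z - 1) = H' (n%:Z - 1)].
  elim: n => [|n [e3 e2 e1]]; first by rewrite !sub0r H1 H1' H2 H2' H3 H3'.
  have -> : n.+1%:Z - 3%:Z = n%:Z - 2%:Z by rewrite -addn1 PoszD -addrA.
  have -> : n.+1%:Z - 2%:Z = n%:Z - 1 by rewrite -addn1 PoszD -addrA.
  have -> : n.+1%:Z - 1 = n%:Z by rewrite -addn1 PoszD addrK.
  split=> //; apply: (mulfI (mulf_neq0 (nzc n) (nzb n))).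
  by rewrite Hr Hr' e1 e2 e3.
by case.
Qed.

End Field.

(* K(q, a, b, c, d), with q, a, b, c, d the indeterminates number 0, ..., 4 *)
Definition ratfun (K : fieldType) : fieldType := {fraction {mpoly K[5]}}.

Definition indet (K : fieldType) (i : nat) : ratfun K :=
  tofrac ('X_(inord i) : {mpoly K[5]}).

Lemma indet_nz (K : fieldType) i j k :
  1 - indet K i * indet K j ^+ k != 0.
Proof.
rewrite /indet -tofracXn -tofracM -tofrac1 -tofracB tofrac_eq0.
apply/eqP => /(congr1 (meval (fun=> 0))).
rewrite mevalB mevalM meval1 meval0 mevalXU mul0r subr0.
by apply/eqP; rewrite oner_eq0.
Qed.

Lemma is_Hseq_ratfun_exists (K : fieldType) :
  exists H, is_Hseq (indet K 0) (indet K 1) (indet K 2) (indet K 3)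
                    (indet K 4) H.
Proof. by apply: is_Hseq_exists => k; apply: indet_nz. Qed.

(* Main.v *)
(** Put h_N = H_(N-1) and h(z) = \sum_N h_N z^N. The recurrence for H becomes a
second-order q-difference equation for h. By Euler's identities,
E(z) = (-z; q)_oo = \sum_m q^(m choose 2) z^m / (q; q)_m and
1 / E(z) = \sum_m (-z)^m / (q; q)_m, so the claim reads h = u E, where
u(z) = \sum_j u_j z^j. Since E(z) = (1 + z) E(qz), substituting h = u E and
dividing by E(qz) leaves
  (1 - c q^(N-1)) (1 - b q^N) u_N
    = (1 + a q^(N-1)) (1 + d q^(N-1)) u_(N-2)
      + (1 - b) (1 - c q^(N-1)) q^N (-1)^N / (q; q)_N,
which the sums defining u_(2n) and u_(2n+1) satisfy term by term. *)

Require Import Defs.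
From mathcomp Require Import all_boot all_order all_algebra.
From mathcomp Require Import mpoly.
From mathcomp Require Import zify ring.

Set Implicit Arguments.
Unset Strict Implicit.
Unset Printing Implicit Defensive.

Import GRing.Theory.
Local Open Scope ring_scope.

(** * Power series as sequences: [conv] is the product, [shift] is multiplication by z *)

Section Convolution.
Variable F : fieldType.
Implicit Types (f g : nat -> F) (N : nat).

Definition conv f g N : F := \sum_(j < N.+1) f j * g (N - j)%N.

Definition shift f N : F := if N is n.+1 then f n else 0.

Lemma conv_shiftr f g N : conv f (shift g) N = shift (conv f g) N.
Proof.
case: N => [|N] /=; first by rewrite /conv big_ord_recr big_ord0 /= mulr0 addr0.
rewrite /conv big_ord_recr /= subnn mulr0 addr0.
by apply: eq_bigr => j _; rewrite subSn // -ltnS.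
Qed.

Lemma conv_shiftl f g N : conv (shift f) g N = shift (conv f g) N.
Proof.
case: N => [|N] /=; first by rewrite /conv big_ord_recr big_ord0 /= mul0r addr0.
by rewrite /conv big_ord_recl mul0r add0r; apply: eq_bigr => j _.
Qed.

End Convolution.

(** * Euler's series E and its inverse S *)

Section Recurrence.
Variables (F : fieldType) (q a b c d : F).
Hypothesis q_nz : q != 0.
Hypothesis q_nroot : forall k, 1 - q ^+ k.+1 != 0.

(** Coefficients of E(z) = (-z; q)_oo and of S(z) = 1 / E(z), by Euler's identities. *)
Definition ecoef m : F := q ^+ 'C(m, 2) / qpoch q q m.
Definition scoef m : F := (-1) ^+ m / qpoch q q m.

Lemma expr_ordB n (j : 'I_n.+1) : q ^+ n = q ^+ j * q ^+ (n - j).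
Proof. by rewrite -exprD subnKC ?leq_ord. Qed.

Lemma qpochS x p n : qpoch x p n.+1 = qpoch x p n * (1 - x * p ^+ n) :> F.
Proof. by rewrite /qpoch big_ord_recr. Qed.

Lemma qpoch0 x p : qpoch x p 0 = 1 :> F.
Proof. by rewrite /qpoch big_ord0. Qed.

Lemma qpoch_nz x p n : (forall k, 1 - x * p ^+ k != 0) -> qpoch x p n != 0 :> F.
Proof. by move=> nz; apply/prodf_neq0 => i _; apply: nz. Qed.

Lemma qpochqq_nz n : qpoch q q n != 0.
Proof. by apply: qpoch_nz => k; rewrite -exprS. Qed.

Lemma ecoef0 : ecoef 0 = 1.
Proof. by rewrite /ecoef qpoch0 expr0 divr1. Qed.

Lemma ecoefS m : ecoef m.+1 = q ^+ m / (1 - q ^+ m.+1) * ecoef m.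
Proof.
rewrite /ecoef qpochS -exprS binS bin1 exprD; field.
by rewrite qpochqq_nz q_nroot.
Qed.

(** Coefficient form of E(z) - E(qz) = z E(qz). *)
Lemma ecoef_rec m : (1 - q ^+ m) * ecoef m = shift (fun i => q ^+ i * ecoef i) m.
Proof.
case: m => [|m] /=; first by rewrite expr0 subrr mul0r.
by rewrite ecoefS; field; rewrite q_nroot.
Qed.

(** Coefficient form of S(z) - S(qz) = - z S(z). *)
Lemma scoef_rec m : (1 - q ^+ m) * scoef m = - shift scoef m.
Proof.
case: m => [|m] /=; first by rewrite expr0 subrr mul0r oppr0.
rewrite /scoef qpochS -exprS [(-1) ^+ m.+1]exprS; field.
by rewrite qpochqq_nz q_nroot.
Qed.

Lemma conv_scoef_ecoef N : conv scoef ecoef N.+1 = 0.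
Proof.
have step M : (1 - q ^+ M.+1) * conv scoef ecoef M.+1
              = - (1 - q ^+ M) * conv scoef ecoef M.
  (* With P = S E, split P(z) - P(qz) as (S(z) - S(qz)) E(z) + S(qz) (E(z) - E(qz)), which equals -
     z P(z) + z P(qz). *)
  have -> : (1 - q ^+ M.+1) * conv scoef ecoef M.+1
      = - conv (shift scoef) ecoef M.+1
        + conv (fun j => q ^+ j * scoef j) (shift (fun i => q ^+ i * ecoef i)) M.+1.
    rewrite /conv mulr_sumr -sumrN -big_split; apply: eq_bigr => j _ /=.
    rewrite -ecoef_rec -mulNr -scoef_rec.
    by rewrite (expr_ordB j); ring.
  rewrite conv_shiftl conv_shiftr /=.
  have -> : conv (fun j => q ^+ j * scoef j) (fun i => q ^+ i * ecoef i) M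
            = q ^+ M * conv scoef ecoef M.
    rewrite /conv mulr_sumr; apply: eq_bigr => j _.
    by rewrite (expr_ordB j); ring.
  by ring.
elim: N => [|N IH].
  by apply: (mulfI (q_nroot 0)); rewrite step expr0 subrr oppr0 mul0r mulr0.
by apply: (mulfI (q_nroot N.+1)); rewrite step IH !mulr0.
Qed.

(** Since S(qz) = (1 + z) S(z), the product S(qz) E(z) is 1 + z. *)
Lemma conv_qscoef_ecoef N : conv (fun j => q ^+ j * scoef j) ecoef N.+2 = 0.
Proof.
have -> : conv (fun j => q ^+ j * scoef j) ecoef N.+2
          = conv scoef ecoef N.+2 + conv (shift scoef) ecoef N.+2.
  rewrite /conv -big_split; apply: eq_bigr => j _ /=.
  by rewrite -[shift _ _]opprK -scoef_rec; ring.
by rewrite conv_shiftl /= !conv_scoef_ecoef addr0.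
Qed.

(** * The two-step recurrence for u *)

Hypothesis b_nz : forall k, 1 - b * q ^+ k != 0.
Hypothesis c_nz : forall k, 1 - c * q ^+ k != 0.

(** The parity [e] treats the summands of [u_even] ([e] = 0) and [u_odd] ([e] = 1) together. *)
Definition uterm e n l : F :=
  (qpoch (- a * q ^+ (2 * l + 1 + e)) (q ^+ 2) (n - l)
     * qpoch (- d * q ^+ (2 * l + 1 + e)) (q ^+ 2) (n - l))
    / (qpoch (b * q ^+ (2 * l + e)) (q ^+ 2) (n - l + 1)
       * qpoch (c * q ^+ (2 * l + 1 + e)) (q ^+ 2) (n - l))
    * (q ^+ (2 * l + e) / qpoch q q (2 * l + e)).

(** Each q-Pochhammer symbol gains one factor, whose exponent does not depend on [l]. *)
Lemma utermS e n l : (l <= n)%N ->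
  (1 - c * q ^+ (2 * n + e).+1) * (1 - b * q ^+ (2 * n + e).+2) * uterm e n.+1 l
  = (1 + a * q ^+ (2 * n + e).+1) * (1 + d * q ^+ (2 * n + e).+1) * uterm e n l.
Proof.
move=> le_ln; rewrite /uterm subSn // !addn1 -(addn1 (2 * l)) !qpochS.
rewrite -!exprM -!mulrA -!exprD.
have -> : (2 * l + 1 + e + 2 * (n - l) = (2 * n + e).+1)%N by lia.
have -> : (2 * l + e + 2 * (n - l).+1 = (2 * n + e).+2)%N by lia.
have bP k : qpoch (b * q ^+ (2 * l + e)) (q ^+ 2) k != 0.
  by apply: qpoch_nz => i; rewrite -mulrA -exprM -exprD.
have cP k : qpoch (c * q ^+ (2 * l + 1 + e)) (q ^+ 2) k != 0.
  by apply: qpoch_nz => i; rewrite -mulrA -exprM -exprD.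
by field; rewrite qpochqq_nz bP cP c_nz !b_nz.
Qed.

Lemma uterm_diag e n :
  uterm e n n = q ^+ (2 * n + e) / qpoch q q (2 * n + e) / (1 - b * q ^+ (2 * n + e)).
Proof.
by rewrite /uterm subnn add0n qpochS !qpoch0 expr0 !mulr1 !mul1r mulrC.
Qed.

(** The old summands follow [utermS]; the new diagonal one, [l] = [n.+1], is the source term. *)
Lemma sum_utermS e n :
  (1 - c * q ^+ (2 * n + e).+1) * (1 - b * q ^+ (2 * n + e).+2)
    * \sum_(l < n.+2) uterm e n.+1 l
  = (1 + a * q ^+ (2 * n + e).+1) * (1 + d * q ^+ (2 * n + e).+1)
      * (\sum_(l < n.+1) uterm e n l)
    + (1 - c * q ^+ (2 * n + e).+1)
      * (q ^+ (2 * n + e).+2 / qpoch q q (2 * n + e).+2).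
Proof.
rewrite big_ord_recr /= mulrDr !mulr_sumr; congr (_ + _).
  by apply: eq_bigr => l _; rewrite utermS // -ltnS.
rewrite uterm_diag mulnS; field.
by rewrite qpochqq_nz b_nz.
Qed.

Local Notation U := (u q a b c d).

Lemma u_evenE n : U (2 * n) = (1 - b) * \sum_(l < n.+1) uterm 0 n l.
Proof.
rewrite u_double; congr (_ * _); apply: eq_bigr => l _.
by rewrite /uterm !addn0.
Qed.

Lemma u_oddE n : U (2 * n).+1 = (b - 1) * \sum_(l < n.+1) uterm 1 n l.
Proof.
rewrite u_doubleS; congr (_ * _); apply: eq_bigr => l _.
by rewrite /uterm -!addnA.
Qed.

(** One formula serves both parities: the sign in [scoef] turns 1 - b into b - 1 for odd indices. *)
Lemma u_rec j :
  (1 - c * q ^+ j.+1) * (1 - b * q ^+ j.+2) * U j.+2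
  = (1 + a * q ^+ j.+1) * (1 + d * q ^+ j.+1) * U j
    + (1 - b) * (1 - c * q ^+ j.+1) * q ^+ j.+2 * scoef j.+2.
Proof.
rewrite /scoef -(odd_double_half j) -mul2n; move: (j./2) => n.
case: (odd j); rewrite ?add1n ?add0n.
  have -> : U (2 * n).+3 = U (2 * n.+1).+1 by rewrite mulnS.
  rewrite !u_oddE mulrCA.
  have := sum_utermS 1 n; rewrite addn1 => ->.
  by rewrite -[(-1) ^+ _]signr_odd /= negbK mul2n odd_double; ring.
have -> : U (2 * n).+2 = U (2 * n.+1) by rewrite mulnS.
rewrite !u_evenE mulrCA.
have := sum_utermS 0 n; rewrite addn0 => ->.
by rewrite -[(-1) ^+ _]signr_odd /= negbK mul2n odd_double; ring.
Qed.

Lemma u0 : U 0 = 1.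
Proof.
rewrite -[0%N]/(2 * 0)%N u_evenE big_ord_recr big_ord0 /= uterm_diag.
have := b_nz 0; rewrite !expr0 qpoch0 !mulr1 => nz.
by rewrite add0r divr1 mul1r divff.
Qed.

Lemma u1 : U 1 = (b - 1) * q / ((1 - q) * (1 - b * q)).
Proof.
rewrite -[1%N]/(2 * 0).+1 u_oddE big_ord_recr big_ord0 /= uterm_diag.
have := b_nz 1; have := q_nroot 0.
rewrite muln0 add0n qpochS qpoch0 expr0 !expr1 mulr1 => nzq nzb; field.
by rewrite nzq nzb.
Qed.

(** * The recurrence for the product u E *)

(* With [h = U * E] and [E z = (1 + z) * E (q z)], the operator of the
   recurrence for [h] becomes [E (q z)] times the two-step operator of
   [u_rec]; this is the coefficientwise form, for [U] replaced by [z ^ j]. *)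
Lemma ecoef_operator j m :
  (1 - c * q ^+ (j + m) / q) * (1 - b * q ^+ (j + m)) * ecoef m
  - (1 - b * c * (q ^+ (j + m)) ^+ 2 / q ^+ 2) * shift ecoef m
  - ((a + d) * q ^+ (j + m) / q + a * d * (q ^+ (j + m)) ^+ 2 / q ^+ 2)
    * shift (shift ecoef) m
  - a * d * (q ^+ (j + m)) ^+ 2 / q ^+ 3 * shift (shift (shift ecoef)) m
  = (1 - c * q ^+ j / q) * (1 - b * q ^+ j) * (q ^+ m * ecoef m)
    - (1 + a * q ^+ j.+1) * (1 + d * q ^+ j.+1)
      * shift (shift (fun i => q ^+ i * ecoef i)) m.
Proof.
rewrite !exprD [q ^+ j.+1]exprS.
(* Some shifts vanish in degrees 0, 1, 2; in higher degrees every term is a rational multiple of the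
   lowest coefficient. *)
case: m => [|[|[|m]]] /=.
- rewrite ecoef0; field; exact: q_nz.
- have := q_nroot 0; rewrite !ecoefS ecoef0 expr0 !expr1 => nz; field.
  by rewrite nz q_nz.
- have := q_nroot 1; have := q_nroot 0; rewrite !ecoefS ecoef0 expr0 !expr1.
  by move=> nz nz1; field; rewrite ?(q_nz, nz, nz1).
have := q_nroot m.+2; have := q_nroot m.+1; have := q_nroot m.
rewrite !ecoefS !exprS => nz nz1 nz2; field.
by rewrite ?(q_nz, nz, nz1, nz2).
Qed.

(** The source of [u_rec] contributes (1 - b) (S(qz) - (c/q) S(q^2 z)) E(qz) = (1 - b) (1 - (c/q) (1
    + qz)), which has no terms of degree 2 or more. *)
Lemma conv_u_source N :
  conv (fun j => (1 - c * q ^+ j / q) * (1 - b * q ^+ j) * U j)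
       (fun i => q ^+ i * ecoef i) N.+2
  = conv (fun j => (1 + a * q ^+ j.+1) * (1 + d * q ^+ j.+1) * U j)
         (fun i => q ^+ i * ecoef i) N.
Proof.
set p := fun i => q ^+ i * ecoef i.
pose src j := (1 - b) * (1 - c * q ^+ j / q) * q ^+ j * scoef j.
set v := fun j => (1 + a * q ^+ j.+1) * (1 + d * q ^+ j.+1) * U j.
(* [u_rec] extends to [j] = 0 and 1, where the double shift is 0, thanks to the values of [u0] and
   [u1]. *)
have E j : (1 - c * q ^+ j / q) * (1 - b * q ^+ j) * U j
           = src j + shift (shift v) j.
  rewrite /src; case: j => [|[|j]] /=.
  - by rewrite u0 /scoef qpoch0 !expr0; field; rewrite q_nz oner_neq0.
  - have := q_nroot 0; have := b_nz 1.
    rewrite u1 /scoef qpochS qpoch0 !expr0 !expr1 => nz nz1; field.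
    by rewrite ?(q_nz, nz, nz1).
  have -> : c * q ^+ j.+2 / q = c * q ^+ j.+1.
    by rewrite [q ^+ j.+2]exprSr mulrA mulfK.
  by rewrite u_rec addrC.
have src0 : conv src p N.+2 = 0.
  transitivity ((1 - b) * q ^+ N.+2 * (conv scoef ecoef N.+2
      - c / q * conv (fun j => q ^+ j * scoef j) ecoef N.+2)).
    rewrite /conv !mulr_sumr -sumrB mulr_sumr; apply: eq_bigr => j _.
    by rewrite (expr_ordB j) /src /p; ring.
  by rewrite conv_scoef_ecoef conv_qscoef_ecoef mulr0 subr0 mulr0.
transitivity (conv src p N.+2 + conv (shift (shift v)) p N.+2).
  by rewrite /conv -big_split; apply: eq_bigr => j _; rewrite E mulrDl.
by rewrite src0 add0r !conv_shiftl /= conv_shiftl.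
Qed.

Lemma conv_u_rec n :
  (1 - c * q ^+ n.+1) * (1 - b * q ^+ n.+2) * conv U ecoef n.+2
  = (1 - b * c * q ^+ (2 * n.+1)) * conv U ecoef n.+1
    + (a * q ^+ n.+1 + d * q ^+ n.+1 + a * d * q ^+ (2 * n.+1)) * conv U ecoef n
    + a * d * q ^+ (2 * n).+1 * shift (conv U ecoef) n.
Proof.
pose p i := q ^+ i * ecoef i.
pose v j := (1 + a * q ^+ j.+1) * (1 + d * q ^+ j.+1) * U j.
have src : _ = shift (shift (conv v p)) n.+2 := conv_u_source n.
(* In [ecoef_operator] the weights involve only j + m, here constantly [n.+2], so they leave the
   convolution. *)
pose X := q ^+ n.+2.
have H : (1 - c * X / q) * (1 - b * X) * conv U ecoef n.+2
  - (1 - b * c * X ^+ 2 / q ^+ 2) * conv U (shift ecoef) n.+2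
  - ((a + d) * X / q + a * d * X ^+ 2 / q ^+ 2)
    * conv U (shift (shift ecoef)) n.+2
  - a * d * X ^+ 2 / q ^+ 3 * conv U (shift (shift (shift ecoef))) n.+2
  = 0.
  transitivity (shift (shift (conv v p)) n.+2
                - conv v (shift (shift p)) n.+2); last first.
    by rewrite !conv_shiftr /= conv_shiftr subrr.
  rewrite -src /conv !mulr_sumr -!sumrB; apply: eq_bigr => j _.
  have := ecoef_operator j (n.+2 - j); rewrite subnKC ?leq_ord // -/X -/p.
  move: (shift _ _) (shift _ _) (shift _ _) (shift _ _) => e1 e2 e3 e4 E.
  have -> : forall w1 w2 w3 w4 x y z t : F,
    w1 * (U j * x) - w2 * (U j * y) - w3 * (U j * z) - w4 * (U j * t)
    = U j * (w1 * x - w2 * y - w3 * z - w4 * t) by move=> *; ring.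
  by rewrite E /v; ring.
rewrite !conv_shiftr /= !conv_shiftr /= conv_shiftr in H.
have X1 : X / q = q ^+ n.+1 by rewrite /X exprSr mulfK.
have X2 : X ^+ 2 / q ^+ 2 = q ^+ (2 * n.+1).
  by rewrite -expr_div_n X1 -exprM mulnC.
have X3 : X ^+ 2 / q ^+ 3 = q ^+ (2 * n).+1.
  by rewrite /X mul2n -addnn !exprS exprD; field.
apply: subr0_eq; rewrite -X1 -X2 -X3 -/X -[RHS]H.
by ring.
Qed.

(** * Identification with H *)

Hypothesis ad_nz : a * d != 0.

Lemma conv_u_1 : conv U ecoef 1 = (1 - b * q)^-1.
Proof.
rewrite /conv !big_ord_recr big_ord0 /= u0 u1 ecoefS ecoef0 expr0 expr1.
have := q_nroot 0; have := b_nz 1; rewrite !expr1 => nzb nzq; field.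
by rewrite nzb nzq.
Qed.

(** Induction on three consecutive values; [shift] supplies the value 0 of H at -2. *)
Lemma Hseq_conv H : is_Hseq q a b c d H ->
  forall n : nat, H n%:Z = conv U ecoef n.+1.
Proof.
case=> H1 H2 H3 Hr n.
suff : [/\ H n%:Z = conv U ecoef n.+1, H (n%:Z - 1) = conv U ecoef n
         & H (n%:Z - 2%:Z) = shift (conv U ecoef) n] by case.
elim: n => [|n [h1 h2 h3]].
  have sub0z (x : int) : 0%:Z - x = - x := sub0r x.
  split; rewrite ?sub0z ?H1 ?H2 //; last first.
    by rewrite /conv big_ord_recr big_ord0 /= u0 ecoef0 add0r mulr1.
  (* At index 0 the value of H at -3 makes the right-hand side 1 - bc + (b - 1) c = 1 - c. *)
  have nzc := c_nz 0; have nzb := b_nz 1.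
  apply: (mulfI (mulf_neq0 nzc nzb)); rewrite Hr !sub0z H1 H2 H3 conv_u_1.
  rewrite exprN1 muln0 !expr0; rewrite expr0 expr1 in nzc nzb.
  by field; move: ad_nz; rewrite mulf_eq0 negb_or nzb q_nz => /andP[-> ->].
have e1 : n.+1%:Z - 1 = n%:Z by lia.
have e2 : n.+1%:Z - 2%:Z = n%:Z - 1 by lia.
have e3 : n.+1%:Z - 3%:Z = n%:Z - 2%:Z by lia.
have e4 : 2%:Z * n.+1%:Z - 1 = (2 * n).+1%:Z by lia.
split; rewrite ?e1 ?e2 //.
apply: (mulfI (mulf_neq0 (c_nz n.+1) (b_nz n.+2))).
by rewrite conv_u_rec Hr e1 e2 e3 e4 h1 h2 h3.
Qed.

End Recurrence.

(** * Specialization to indeterminates *)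

Lemma indet_neq0 (K : fieldType) i : indet K i != 0.
Proof.
rewrite /indet tofrac_eq0; apply/eqP => /(congr1 (meval (fun=> 1))).
by rewrite mevalXU meval0; apply/eqP; rewrite oner_eq0.
Qed.

Theorem theorem3p1 (K : fieldType) (H : int -> ratfun K) :
  let q := indet K 0 in
  let a := indet K 1 in
  let b := indet K 2 in
  let c := indet K 3 in
  let d := indet K 4 in
  is_Hseq q a b c d H ->
  forall k : nat, (0 < k)%N ->
    H k%:Z = \sum_(j < k + 2)
      u q a b c d j * q ^+ 'C(k + 1 - j, 2) / qpoch q q (k + 1 - j).
Proof.
move=> q a b c d Hseq k _.
(* [indet_nz] applied to q twice: q is not a root of unity. *)
have q_nroot i : 1 - q ^+ i.+1 != 0 by rewrite exprS; apply: indet_nz.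
rewrite (Hseq_conv (indet_neq0 K 0) q_nroot _ _ _ Hseq).
- by rewrite addn1 addn2 /conv; apply: eq_bigr => j _; rewrite mulrA.
- by move=> i; apply: indet_nz.
- by move=> i; apply: indet_nz.
by rewrite mulf_neq0 ?indet_neq0.
Qed.
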